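(* For every fixed integer $k\ge 2$ there is an algorithm that, given a graph $G=(V,E)$, decides whether $G$ has a minimal clique transversal of size at least $k$ (i.e., whether $\tau_c^+(G)\ge k$), in time $\mathcal{O}(|V|^{3k-3})$.
   Context: Graphs are finite, simple and undirected. A clique transversal of a graph $G$ is a set of vertices intersecting every (inclusion-)maximal clique of $G$; it is minimal if no proper subset is a clique transversal. The upper clique transversal number $\tau_c^+(G)$ is the maximum size of a minimal clique transversal of $G$. *)

(* Defs.v *)
From mathcomp Require Import all_boot.

Set Implicit Arguments.
Unset Strict Implicit.
Unset Printing Implicit Defensive.

Record sgraph := SGraph {
  vertex :> finType;
  adj : rel vertex;
  adj_sym : symmetric adj;
  adj_irrefl : irreflexive adj }.

Section CliqueTransversals.
Variable G : sgraph.

Definition is_clique (K : {set G}) : bool :=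
  [forall x in K, forall y in K, (x != y) ==> adj x y].

Definition maximal_clique (K : {set G}) : bool := maxset is_clique K.

Definition clique_transversal (X : {set G}) : bool :=
  [forall K : {set G}, maximal_clique K ==> (X :&: K != set0)].

Definition minimal_clique_transversal (X : {set G}) : bool :=
  minset clique_transversal X.

(* The empty set is a maximal clique of the null graph, which therefore has no
   clique transversal; the maximum is 0 in that case. *)
Definition upper_clique_transversal_number : nat :=
  \max_(X : {set G} | minimal_clique_transversal X) #|X|.

End CliqueTransversals.

Definition has_large_minimal_clique_transversal (k : nat) (G : sgraph) : Prop :=
  exists X : {set G}, minimal_clique_transversal X /\ k <= #|X|.

Lemma has_large_minimal_clique_transversalE (k : nat) (G : sgraph) :
  0 < k ->
  has_large_minimal_clique_transversal k G <->
  k <= upper_clique_transversal_number G.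
Proof.
move=> k_gt0; split=> [[X [minX leX]]|le_k].
  by apply: (leq_trans leX); apply: (leq_bigmax_cond (F := fun X : {set G} => #|X|)).
case: (pickP (@minimal_clique_transversal G)) => [X0 minX0|noX]; last first.
  by move: le_k; rewrite /upper_clique_transversal_number big_pred0 // leqNgt k_gt0.
have [|X minX defX] := @eq_bigmax_cond _ (@minimal_clique_transversal G)
                         (fun X : {set G} => #|X|).
  by apply/card_gt0P; exists X0.
by exists X; split; rewrite // -defX.
Qed.

(* Model of computation: programs for a word RAM with words of w bits.  The
   machine has a read-only random-access input array and a random-access
   memory, both addressed by words; arithmetic is modulo 2 ^ w.  Every
   operation, memory access and test has unit cost. *)

Inductive binop := Add | Sub | Mul | Div | Mod | Eq | Lt.

Inductive expr :=
  | Const of nat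
  | Input of expr
  | Read of expr
  | Op of binop & expr & expr.

Inductive prog :=
  | Skip
  | Write of expr & expr
  | Seq of prog & prog
  | If of expr & prog & prog
  | While of expr & prog.

Definition memory := nat -> nat.

Definition empty_memory : memory := fun _ => 0.

Definition update (m : memory) (a v : nat) : memory :=
  fun b => if b == a then v else m b.

Section Semantics.
Variables (w : nat) (inp : seq nat).

Definition to_word (x : nat) : nat := x %% 2 ^ w.

(* x and y are words; subtraction wraps around, and dividing by 0 gives
   x %/ 0 = 0 and x %% 0 = x. *)
Definition eval_binop (o : binop) (x y : nat) : nat :=
  to_word match o with
          | Add => x + y
          | Sub => 2 ^ w + x - y
          | Mul => x * y
          | Div => x %/ y
          | Mod => x %% y
          | Eq => x == y
          | Lt => x < y
          end.

Fixpoint eval (m : memory) (e : expr) : nat :=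
  match e with
  | Const x => to_word x
  | Input a => to_word (nth 0 inp (eval m a))
  | Read a => m (eval m a)
  | Op o e1 e2 => eval_binop o (eval m e1) (eval m e2)
  end.

Fixpoint cost (e : expr) : nat :=
  match e with
  | Const _ => 1
  | Input a => (cost a).+1
  | Read a => (cost a).+1
  | Op _ e1 e2 => (cost e1 + cost e2).+1
  end.

(* [exec p m t m'] : started in memory [m], program [p] halts after [t] time
   units with memory [m']. *)
Inductive exec : prog -> memory -> nat -> memory -> Prop :=
  | ExecSkip m : exec Skip m 1 m
  | ExecWrite a e m :
      exec (Write a e) m (cost a + cost e).+1 (update m (eval m a) (eval m e))
  | ExecSeq p q m m1 m2 t1 t2 :
      exec p m t1 m1 -> exec q m1 t2 m2 -> exec (Seq p q) m (t1 + t2) m2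
  | ExecIfTrue e p q m m1 t :
      eval m e != 0 -> exec p m t m1 -> exec (If e p q) m (cost e + t).+1 m1
  | ExecIfFalse e p q m m1 t :
      eval m e = 0 -> exec q m t m1 -> exec (If e p q) m (cost e + t).+1 m1
  | ExecWhileTrue e p m m1 m2 t1 t2 :
      eval m e != 0 -> exec p m t1 m1 -> exec (While e p) m1 t2 m2 ->
      exec (While e p) m (cost e + t1 + t2).+1 m2
  | ExecWhileFalse e p m :
      eval m e = 0 -> exec (While e p) m (cost e).+1 m.

Lemma exec_det p m t1 m1 t2 m2 :
  exec p m t1 m1 -> exec p m t2 m2 -> t1 = t2 /\ m1 = m2.
Proof.
move=> H; elim: H t2 m2 => {p m t1 m1}.
- by move=> m t2 m2 H; inversion H; subst.
- by move=> a e m t2 m2 H; inversion H; subst.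
- move=> p q m m1 m2 t1 t2 _ IH1 _ IH2 t m3 H; inversion H; subst.
  have [? ?] := IH1 _ _ ltac:(eassumption); subst.
  by have [? ?] := IH2 _ _ ltac:(eassumption); subst.
- move=> e p q m m1 t ne0 _ IH t2 m2 H; inversion H; subst.
    by have [? ?] := IH _ _ ltac:(eassumption); subst.
  by move: ne0; match goal with E : eval _ _ = 0 |- _ => rewrite E end.
- move=> e p q m m1 t e0 _ IH t2 m2 H; inversion H; subst.
    by match goal with E : is_true (eval _ _ != 0) |- _ => move: E; rewrite e0 end.
  by have [? ?] := IH _ _ ltac:(eassumption); subst.
- move=> e p m m1 m2 t1 t2 ne0 _ IH1 _ IH2 t m3 H; inversion H; subst.
    have [? ?] := IH1 _ _ ltac:(eassumption); subst.
    by have [? ?] := IH2 _ _ ltac:(eassumption); subst.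
  by move: ne0; match goal with E : eval _ _ = 0 |- _ => rewrite E end.
- move=> e p m e0 t2 m2 H; inversion H; subst => //.
  by match goal with E : is_true (eval _ _ != 0) |- _ => move: E; rewrite e0 end.
Qed.

End Semantics.

(* The number of vertices, followed by the adjacency matrix row by row. *)
Definition encode (G : sgraph) : seq nat :=
  #|G| :: [seq nat_of_bool (adj x y) | x <- enum G, y <- enum G].

(* Words of O(log n) bits, where n is the number of vertices. *)
Definition word_size (c n : nat) : nat := c * (trunc_log 2 n).+1.

Definition decides_in_time (c : nat) (p : prog) (P : sgraph -> Prop)
    (T : nat -> nat) : Prop :=
  forall G : sgraph, exists (t : nat) (m : memory),
    [/\ exec (word_size c #|G|) (encode G) p empty_memory t m,
        t <= T #|G|,
        P G -> m 0 = 1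
      & ~ P G -> m 0 = 0].

Definition big_O (f g : nat -> nat) : Prop :=
  exists C n0 : nat, forall n : nat, n0 <= n -> f n <= C * g n.

Definition decidable_in_time_O (P : sgraph -> Prop) (g : nat -> nat) : Prop :=
  exists (c : nat) (p : prog) (T : nat -> nat),
    big_O T g /\ decides_in_time c p P T.

(* Main.v *)
Require Import Defs.
From mathcomp Require Import all_boot zify.

(** Put r = k - 1 and call a clique transversal small if it has at most r
    vertices.  A minimal clique transversal with more than r vertices exists iff
    some clique transversal X contains no small one, i.e. iff the small clique
    transversals, as a hypergraph, have a minimal transversal T (inside the
    complement of X) which contains no maximal clique.  If T is a clique, a
    vertex z extending it is adjacent to a vertex of every small clique
    transversal.  Otherwise T contains nonadjacent u and v; if S and S' are small
    with S ∩ T = {u} and S' ∩ T = {v}, then no small clique transversal lies in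
    (S ∪ S') \ {u, v}.  Conversely, in the first case the non-neighbors of z, and
    in the second case (S ∪ S') \ {u, v}, form a clique transversal without small
    ones.

    An r-tuple is a clique transversal iff there is no clique w_1, ..., w_r such
    that w_i is a non-neighbor of its i-th vertex.  In the second case only a
    number of r-tuples depending on r alone lies in (S ∪ S') \ {u, v}.  So both
    conditions are first-order sentences of quantifier rank at most 3 r, and a
    sentence of quantifier rank q is evaluated by nested loops in O(n ^ q)
    steps. *)

Set Implicit Arguments.
Unset Strict Implicit.
Unset Printing Implicit Defensive.

(** * Bounded certificates *)

Section Transversals.
Variable G : sgraph.
Implicit Types (S T K X : {set G}) (x y z u v : G).

Lemma cliqueP K :
  reflect {in K &, forall x y, x != y -> adj x y} (is_clique K).
Proof.
apply: (iffP forall_inP) => [clK x y Kx Ky|clK x Kx].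
  by move: (clK x Kx) => /forall_inP /(_ y Ky) /implyP.
by apply/forall_inP => y Ky; apply/implyP; apply: clK.
Qed.

Lemma clique_transversalP X :
  reflect (forall K, maximal_clique K -> exists2 x, x \in X & x \in K)
          (clique_transversal X).
Proof.
apply: (iffP forallP) => [tX K maxK|tX K].
  by move: (tX K); rewrite maxK => /set0Pn[x /setIP[]]; exists x.
by apply/implyP => /tX[x Xx Kx]; apply/set0Pn; exists x; rewrite inE Xx.
Qed.

(** The empty clique extends to a maximal one, which [X] must meet. The vertex obtained later pads a
    listing of [X] to length [r]. *)
Lemma clique_transversal_neq0 X : clique_transversal X -> X != set0.
Proof.
have clq0 : is_clique (set0 : {set G}) by apply/cliqueP => x y; rewrite inE.
have [K maxK _] := maxset_exists clq0.
by move/clique_transversalP/(_ K maxK)=> [x Xx _]; apply/set0Pn; exists x.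
Qed.

(** Otherwise maximality would put [z] itself in [K], against irreflexivity. *)
Lemma common_neighbor_not_maximal_clique K z :
  {in K, forall x, adj z x} -> ~~ maximal_clique K.
Proof.
move=> zK; apply/negP => /maxsetP[/cliqueP clK maxK].
have Kz : z \in K.
  rewrite -(maxK (z |: K)) ?setU11 ?subsetUr //.
  apply/cliqueP => x y /setU1P[->|Kx] /setU1P[->|Ky]; rewrite ?eqxx //.
  - by move=> _; apply: zK.
  - by move=> _; rewrite adj_sym; apply: zK.
  - exact: clK.
by have := zK z Kz; rewrite adj_irrefl.
Qed.

Lemma non_maximal_clique_extension K :
  is_clique K -> ~~ maximal_clique K -> exists z, {in K, forall x, adj z x}.
Proof.
move=> clK; have [K' maxK' subKK'] := maxset_exists clK => nmaxK.
have /properP[_ [z K'z nKz]] : K \proper K'.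
  by rewrite properEneq subKK' andbT; apply: contraNneq nmaxK => ->.
have /maxsetP[/cliqueP clK' _] := maxK'.
exists z => x Kx; apply: clK' => //; first exact: (subsetP subKK').
by apply: contraNneq nKz => ->.
Qed.

(* A vertex outside a maximal clique has a non-neighbor in it; choosing one for
   each [e i] turns a maximal clique avoiding [e] into a small clique. *)
Lemma not_clique_transversal_imsetP (I : finType) (e : I -> G) :
  reflect (exists w : I -> G,
             (forall i, w i != e i /\ ~~ adj (w i) (e i)) /\
             (forall i j, (w i == w j) || adj (w i) (w j)))
          (~~ clique_transversal [set e i | i in I]).
Proof.
apply: (iffP idP) => [|[w [we clw]]].
  case/forallPn=> K; rewrite negb_imply negbK => /andP[maxK /eqP disjK].
  have /maxsetP[/cliqueP clK _] := maxK.
  have nK i : e i \notin K.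
    apply/negP => Ki; have : e i \in [set e i | i in I] :&: K.
      by rewrite inE Ki andbT imset_f.
    by rewrite disjK inE.
  have ex_w i : exists x, (x \in K) && ~~ adj (e i) x.
    apply/existsP; rewrite -negb_forall_in.
    by apply: contraL maxK => /forall_inP/common_neighbor_not_maximal_clique.
  exists (fun i => xchoose (ex_w i)); split=> [i|i j].
    have /andP[Kw nadj] := xchooseP (ex_w i); rewrite adj_sym; split=> //.
    by apply: contraNneq (nK i) => <-.
  have /andP[Ki _] := xchooseP (ex_w i); have /andP[Kj _] := xchooseP (ex_w j).
  by case: eqP => //= /eqP; apply: clK.
have clqw : is_clique [set w i | i in I].
  apply/cliqueP => _ _ /imsetP[i _ ->] /imsetP[j _ ->].
  by case/orP: (clw i j) => [->|].
have [K maxK subK] := maxset_exists clqw.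
have /maxsetP[/cliqueP clK _] := maxK.
apply/negP => /clique_transversalP/(_ K maxK)[_ /imsetP[i _ ->] Ke].
have [wei /negP[]] := we i.
by apply: clK => //; rewrite (subsetP subK) // imset_f.
Qed.

(** * Small clique transversals and the two kinds of certificates *)

Section Bounded.
Variable r : nat.

Definition small_transversal S := (#|S| <= r) && clique_transversal S.

Definition has_dominating_vertex :=
  [exists z, forall S, small_transversal S ==> [exists x in S, adj z x]].

Definition exchange_free (S T : {set G}) u v :=
  [&& u \notin T, v \notin S, ~~ adj u v &
   [forall R : {set G}, (R \subset (S :|: T) :\: [set u; v]) ==>
                        ~~ small_transversal R]].

Definition has_exchange_free_pair :=
  [exists S, exists T, [&& small_transversal S, small_transversal T &
   [exists u in S, exists v in T, exchange_free S T u v]]].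

(** A minimal transversal inside [X] is not small, so it must have more than [r] vertices. *)
Lemma clique_transversal_large X :
    clique_transversal X ->
    (forall S, S \subset X -> ~~ small_transversal S) ->
  has_large_minimal_clique_transversal r.+1 G.
Proof.
move=> tX nX; have [Y minY subYX] := minset_exists tX.
exists Y; split=> //; have := nX Y subYX.
by rewrite /small_transversal (minsetp minY) andbT -ltnNge.
Qed.

Lemma has_large_minimal_clique_transversalS :
  has_large_minimal_clique_transversal r.+1 G <->
  has_dominating_vertex || has_exchange_free_pair.
Proof.
split=> [[X [minX geX]]|/orP[]]; last first.
- case/existsP=> S /existsP[T /and3P[/andP[_ tS] /andP[_ tT]]].
  case/exists_inP=> u Su /exists_inP[v Tv /and4P[nTu nSv nuv /forallP nW]].
  apply: (@clique_transversal_large ((S :|: T) :\: [set u; v])); last first.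
    by move=> R subR; have := nW R; rewrite subR.
  apply/clique_transversalP => K maxK.
  have /maxsetP[/cliqueP clK _] := maxK.
  have /clique_transversalP/(_ K maxK)[x Sx Kx] := tS.
  have /clique_transversalP/(_ K maxK)[y Ty Ky] := tT.
  (* A point of [S] in [K] other than [u] already lies in the set, since [v] is not in [S];
     symmetrically for [T]. What remains is that the clique [K] contains both [u] and [v], which are
     distinct and nonadjacent. *)
  have [xu|nxu] := eqVneq x u; last first.
    exists x => //; rewrite !inE Sx negb_or nxu /= andbT.
    by apply: contraNneq nSv => <-.
  have [yv|nyv] := eqVneq y v; last first.
    exists y => //; rewrite !inE Ty negb_or nyv /= orbT !andbT.
    by apply: contraNneq nTu => <-.
  case/negP: nuv; rewrite -xu -yv; apply: clK => //.
  by rewrite yv; apply: contraNneq nSv => <-.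
- case/existsP=> z /forallP domz.
  apply: (@clique_transversal_large [set x | ~~ adj z x]).
    apply/clique_transversalP => K maxK.
    have /forall_inPn[x Kx nzx] : ~~ [forall x in K, adj z x].
      by apply: contraL maxK => /forall_inP/common_neighbor_not_maximal_clique.
    by exists x; rewrite ?inE.
  move=> S subS; apply/negP => smallS; move: (domz S); rewrite smallS /=.
  by case/exists_inP=> x Sx zx; have := subsetP subS x Sx; rewrite inE zx.
have [tX] := minsetP minX => minX'.
pose hits (T : {set G}) :=
  [forall S, small_transversal S ==> (S :&: T != set0)].
(* A small transversal inside [X] would equal [X] by minimality, but [X] has more than [r]
   vertices. *)
have hitsX : hits (~: X).
  apply/forallP => S; apply/implyP => /andP[leS tS].
  rewrite setI_eq0 disjoints_subset setCK.
  by apply/negP => /(minX' _ tS) eSX; move: leS; rewrite eSX leqNgt geX.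
have [T minT subT] := minset_exists hitsX.
have [/forallP hitT minT'] := minsetP minT.
have nmaxT : ~~ maximal_clique T.
  apply/negP => maxT; have /clique_transversalP/(_ T maxT)[x Xx Tx] := tX.
  by have := subsetP subT x Tx; rewrite inE Xx.
(* Since [T] is minimal, removing [x] leaves some small transversal unhit; that one meets [T] in [x]
   alone. *)
have private x : x \in T ->
    exists2 S, small_transversal S & S :&: T = [set x].
  move=> Tx; have : ~~ hits (T :\ x).
    apply/negP => /minT'/(_ (subsetDl _ _)) eT.
    by have := Tx; rewrite -eT !inE eqxx.
  case/forallPn=> S; rewrite negb_imply negbK => /andP[smallS /eqP disj].
  have STx y : y \in S -> y \in T -> y = x.
    move=> Sy Ty; apply/eqP/negPn/negP => nyx.
    by have := in_set0 y; rewrite -disj !inE Sy Ty nyx.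
  exists S => //; apply/setP => y; rewrite !inE.
  apply/andP/eqP => [[]|->]; first exact: STx.
  have := hitT S; rewrite smallS => /set0Pn[y' /setIP[Sy' Ty']].
  by rewrite -(STx y').
have [clT|] := boolP (is_clique T).
  have [z domz] := non_maximal_clique_extension clT nmaxT.
  apply/orP; left; apply/existsP; exists z; apply/forallP => S.
  apply/implyP => smallS; have := hitT S; rewrite smallS.
  by case/set0Pn=> x /setIP[Sx Tx]; apply/exists_inP; exists x; rewrite ?domz.
case/forall_inPn=> u Tu /forall_inPn[v Tv]; rewrite negb_imply => /andP[neuv nuv].
have [Su smallSu /setP eSu] := private u Tu.
have [Sv smallSv /setP eSv] := private v Tv.
apply/orP; right; apply/existsP; exists Su; apply/existsP; exists Sv.
rewrite smallSu smallSv.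
apply/exists_inP; exists u; first by have := eSu u; rewrite !inE eqxx => /andP[].
apply/exists_inP; exists v; first by have := eSv v; rewrite !inE eqxx => /andP[].
apply/and4P; split=> //.
- by have := eSv u; rewrite !inE Tu andbT (negPf neuv) => ->.
- by have := eSu v; rewrite !inE Tv andbT eq_sym (negPf neuv) => ->.
(* [Su] and [Sv] meet [T] only in [u] and [v], so [R] would be a small transversal missed by [T]. *)
apply/forallP => R; apply/implyP => subR; apply/negP => smallR.
have := hitT R; rewrite smallR => /set0Pn[x /setIP[Rx Tx]].
have := subsetP subR x Rx; rewrite !inE negb_or => /andP[/andP[nxu nxv]].
by case/orP=> Sx; [have := eSu x | have := eSv x];
  rewrite !inE Sx Tx ?(negPf nxu) ?(negPf nxv).
Qed.

End Bounded.
End Transversals.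

(** * First-order queries on the word RAM *)

Lemma nth_allpairs (A B C : Type) (c : C) (a : A) (b : B) (f : A -> B -> C)
    (s : seq A) (t : seq B) i j :
  i < size s -> j < size t ->
  nth c [seq f x y | x <- s, y <- t] (i * size t + j) = f (nth a s i) (nth b t j).
Proof.
elim: s i => // x s IHs [_ ltj|i lti ltj] /=.
  by rewrite mul0n add0n nth_cat size_map ltj (nth_map b).
rewrite nth_cat size_map mulSn -addnA ltnNge leq_addr /= addKn.
exact: IHs.
Qed.

(** * Ranks of vertices and word bounds *)

Definition code (G : sgraph) (x : G) : nat := index x (enum G).

Lemma ltn_code (G : sgraph) (x : G) : code x < #|G|.
Proof. by rewrite cardE index_mem mem_enum. Qed.

Lemma eq_code (G : sgraph) (x y : G) : (code x == code y) = (x == y).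
Proof.
apply/eqP/eqP => [exy|->//].
by rewrite -(nth_index x (mem_enum G x)) -/(code x) exy nth_index ?mem_enum.
Qed.

Lemma nth_encode (G : sgraph) (x y : G) :
  nth 0 (encode G) (code x * #|G| + code y).+1 = adj x y.
Proof.
have szG := cardE G; rewrite /= {1}szG (@nth_allpairs _ _ _ _ x y) -?szG ?ltn_code //.
by rewrite !nth_index ?mem_enum.
Qed.

Lemma word_size_const c n a : a <= c -> a < 2 ^ word_size c n.
Proof.
move=> le_ac; apply: leq_ltn_trans (ltn_expl _ (ltnSn 1)).
by apply: leq_trans le_ac _; rewrite leq_pmulr.
Qed.

(** Positions in the adjacency matrix go up to [n ^ 2] and must fit in a word. *)
Lemma word_size_sqr c n : 2 <= c -> n ^ 2 < 2 ^ word_size c n.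
Proof.
move=> c_ge2; apply: (@leq_trans (2 ^ (2 * (trunc_log 2 n).+1))).
  by rewrite mulnC expnM ltn_exp2r // trunc_log_ltn.
by rewrite leq_exp2l // leq_mul2r c_ge2 orbT.
Qed.

Lemma to_word_small w x : x < 2 ^ w -> to_word w x = x.
Proof. exact: modn_small. Qed.

(** A valuation assigns a vertex to every variable, so it exists only on a nonempty graph; the null
    graph is treated apart in [checkable_decidable]. *)
Definition query := forall G : sgraph, (nat -> G) -> bool.

(* [P] is answered in time [C * n ^ q], where variable [i] is stored at address [i.+1] as the rank
   of its value, for [i < d], and the answer is left at address [0]. *)
Definition checkable (d q : nat) (P : query) : Prop :=
  exists (p : prog) (C c0 : nat), forall c (G : sgraph) (rho : nat -> G) m,
    c0 <= c -> (forall i, i < d -> m i.+1 = code (rho i)) ->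
  exists t m', [/\ exec (word_size c #|G|) (encode G) p m t m',
    t <= C * #|G| ^ q, m' 0 = P G rho & forall i, i < d -> m' i.+1 = m i.+1].

Lemma card_valuation_gt0 (G : sgraph) (rho : nat -> G) : 0 < #|G|.
Proof. by apply/card_gt0P; exists (rho 0). Qed.

Lemma checkable_ext d q (P Q : query) :
  (forall G rho, P G rho = Q G rho) -> checkable d q P -> checkable d q Q.
Proof.
move=> eqPQ [p [C [c0 runP]]]; exists p, C, c0 => c G rho m le_c rhom.
by have [t [m' []]] := runP c G rho m le_c rhom; rewrite eqPQ; exists t, m'.
Qed.

Lemma checkable_leq d q q' P : q <= q' -> checkable d q P -> checkable d q' P.
Proof.
move=> leqq [p [C [c0 runP]]]; exists p, C, c0 => c G rho m le_c rhom.
have [t [m' [ex_p le_t m'0 m'S]]] := runP c G rho m le_c rhom.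
exists t, m'; split=> //; apply: leq_trans le_t _.
by rewrite leq_mul2l leq_pexp2l ?orbT ?(card_valuation_gt0 rho).
Qed.

(* A program that finds only the first [d] values in memory cannot distinguish
   valuations agreeing on them. *)
Lemma checkable_local d q P (G : sgraph) (rho rho' : nat -> G) :
  checkable d q P -> (forall i, i < d -> rho i = rho' i) -> P G rho = P G rho'.
Proof.
move=> [p [C [c0 runP]]] eqrho; pose m a := code (rho a.-1).
have [//|t [m1 [ex1 _ m10 _]]] := runP c0 G rho m (leqnn _).
have [i lti|t' [m2 [ex2 _ m20 _]]] := runP c0 G rho' m (leqnn _).
  by rewrite -eqrho.
have [_ eqm] := exec_det ex1 ex2.
by move: m10; rewrite eqm m20; case: (P G rho); case: (P G rho').
Qed.

Lemma checkable_expr d (P : query) e c0 :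
    (forall c (G : sgraph) (rho : nat -> G) m, c0 <= c ->
       (forall i, i < d -> m i.+1 = code (rho i)) ->
     eval (word_size c #|G|) (encode G) m e = P G rho) ->
  checkable d 0 P.
Proof.
move=> evalP; exists (Write (Const 0) e), (cost (Const 0) + cost e).+1, c0.
move=> c G rho m le_c rhom; eexists _, _; split.
- exact: ExecWrite.
- by rewrite muln1.
- by rewrite /update /= to_word_small ?expn_gt0 // eqxx (evalP _ _ rho).
- by move=> i lti; rewrite /update /= to_word_small ?expn_gt0.
Qed.

(** * Constant-time atoms *)

Lemma checkable_true d : checkable d 0 (fun _ _ => true).
Proof.
apply: (@checkable_expr _ _ (Const 1) 1) => c G rho m le_c _ /=.
by rewrite to_word_small ?word_size_const.
Qed.

Lemma checkable_eq d i j : i < d -> j < d ->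
  checkable d 0 (fun _ rho => rho i == rho j).
Proof.
move=> lti ltj; pose e := Op Eq (Read (Const i.+1)) (Read (Const j.+1)).
apply: (@checkable_expr _ _ e d.+1) => c G rho m le_c rhom /=.
rewrite !(to_word_small (word_size_const _ _)) ?rhom //; try lia.
rewrite /eval_binop eq_code to_word_small // word_size_const //.
by apply: leq_trans (leq_b1 _) _; lia.
Qed.

Lemma checkable_adj d i j : i < d -> j < d ->
  checkable d 0 (fun _ rho => adj (rho i) (rho j)).
Proof.
move=> lti ltj.
(* [Input (Const 0)] is the number of vertices; the leading 1 skips that entry of the encoding. *)
pose e := Input (Op Add (Const 1) (Op Add
   (Op Mul (Read (Const i.+1)) (Input (Const 0))) (Read (Const j.+1)))).
apply: (@checkable_expr _ _ e d.+2) => c G rho m le_c rhom.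
have le2c : 2 <= c by lia.
have sqr := word_size_sqr #|G| le2c.
have lt_n : #|G| < 2 ^ word_size c #|G| by apply: leq_ltn_trans sqr; nia.
have lti' := ltn_code (rho i); have ltj' := ltn_code (rho j).
have lt_ij : (code (rho i) * #|G| + code (rho j)).+1 < 2 ^ word_size c #|G|.
  by apply: leq_ltn_trans sqr; rewrite expnS expn1; nia.
have adjE := nth_encode (rho i) (rho j).
have : nth 0 (encode G) 0 = #|G| by [].
move: (encode G) adjE => inp adjE inp0.
have small a : a <= c -> to_word (word_size c #|G|) a = a.
  by move=> le_a; rewrite to_word_small ?word_size_const.
rewrite /e /eval (small 0) ?(small 1) ?(small i.+1) ?(small j.+1); try lia.
rewrite inp0 !rhom // (to_word_small lt_n) /eval_binop.
rewrite [to_word _ (_ * _)]to_word_small; last by lia.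
rewrite [to_word _ (_ + code _)]to_word_small; last by lia.
rewrite add1n (to_word_small lt_ij) adjE small //.
by apply: leq_trans (leq_b1 _) (ltnW le2c).
Qed.

(** * Boolean connectives and quantifiers over fixed index types *)

Lemma checkable_neg d q P :
  checkable d q P -> checkable d q (fun G rho => ~~ P G rho).
Proof.
case=> p [C [c0 runP]].
pose neg0 := Write (Const 0) (Op Eq (Read (Const 0)) (Const 0)).
(* [neg0] costs 6, and [c0.+1] makes 1 a word. *)
exists (Seq p neg0), (C + 6), c0.+1 => c G rho m lt_c rhom.
have [t [m' [ex_p le_t m'0 m'S]]] := runP c G rho m (ltnW lt_c) rhom.
eexists _, _; split; first by apply: ExecSeq ex_p _; apply: ExecWrite.
- have : 0 < #|G| ^ q by rewrite expn_gt0 (card_valuation_gt0 rho).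
  by rewrite /=; move: (_ ^ _) le_t => N le_t N_gt0; nia.
- rewrite /update /= [to_word _ 0]to_word_small ?expn_gt0 // eqxx m'0.
  by rewrite /eval_binop; case: (P G rho); rewrite to_word_small ?word_size_const //; lia.
- by move=> i lti; rewrite /update /= to_word_small ?expn_gt0 // m'S.
Qed.

Lemma checkable_and d q P Q :
    checkable d q P -> checkable d q Q ->
  checkable d q (fun G rho => P G rho && Q G rho).
Proof.
case=> p1 [C1 [c1 runP]] [p2 [C2 [c2 runQ]]].
exists (Seq p1 (If (Read (Const 0)) p2 Skip)), (C1 + C2 + 5), (maxn c1 c2).
move=> c G rho m; rewrite geq_max => /andP[le_c1 le_c2] rhom.
have [t1 [m1 [ex1 le_t1 m10 m1S]]] := runP c G rho m le_c1 rhom.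
have [i lti|t2 [m2 [ex2 le_t2 m20 m2S]]] := runQ c G rho m1 le_c2.
  by rewrite m1S // rhom.
have n_gt0 : 0 < #|G| ^ q by rewrite expn_gt0 (card_valuation_gt0 rho).
have test : eval (word_size c #|G|) (encode G) m1 (Read (Const 0)) = P G rho.
  by rewrite /= to_word_small ?expn_gt0.
case: (P G rho) test m10 => test m10.
  exists (t1 + (cost (Read (Const 0)) + t2).+1), m2; split=> //.
  - by apply: ExecSeq ex1 _; apply: ExecIfTrue; rewrite ?test.
  - by rewrite /=; move: (_ ^ _) n_gt0 le_t1 le_t2 => N; nia.
  - by move=> i lti; rewrite m2S ?m1S.
exists (t1 + (cost (Read (Const 0)) + 1).+1), m1; split=> //.
- by apply: ExecSeq ex1 _; apply: ExecIfFalse => //; apply: ExecSkip.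
- by rewrite /=; move: (_ ^ _) n_gt0 le_t1 => N; nia.
Qed.

(** The list [s] does not depend on the graph, so the conjunction unrolls into a fixed program and
    leaves the exponent unchanged. *)
Lemma checkable_all d q (I : eqType) (s : seq I) (P : I -> query) :
    (forall i, checkable d q (P i)) ->
  checkable d q (fun G rho => all (fun i => P i G rho) s).
Proof.
move=> chkP; elim: s => [|i s IHs] /=; last exact: checkable_and.
exact: checkable_leq (leq0n q) (checkable_true d).
Qed.

Lemma checkable_forall d q (I : finType) (P : I -> query) :
    (forall i, checkable d q (P i)) ->
  checkable d q (fun G rho => [forall i, P i G rho]).
Proof.
move=> chkP; apply: checkable_ext (checkable_all (enum I) chkP) => G rho.
apply/allP/forallP => [allP i|allP i _]; last exact: allP.
by apply: allP; rewrite mem_enum.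
Qed.

Lemma checkable_or d q P Q :
    checkable d q P -> checkable d q Q ->
  checkable d q (fun G rho => P G rho || Q G rho).
Proof.
move=> chkP chkQ.
apply: checkable_ext (checkable_neg (checkable_and (checkable_neg chkP)
  (checkable_neg chkQ))) => G rho.
by rewrite negb_and !negbK.
Qed.

Lemma checkable_imply d q P Q :
    checkable d q P -> checkable d q Q ->
  checkable d q (fun G rho => P G rho ==> Q G rho).
Proof.
move=> chkP chkQ; apply: checkable_ext (checkable_or (checkable_neg chkP) chkQ).
by move=> G rho; rewrite implybE.
Qed.

Lemma checkable_exists d q (I : finType) (P : I -> query) :
    (forall i, checkable d q (P i)) ->
  checkable d q (fun G rho => [exists i, P i G rho]).
Proof.
move=> chkP.
apply: checkable_ext (checkable_neg (checkable_forall
  (fun i => checkable_neg (chkP i)))) => G rho.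
by rewrite negb_forall; apply: eq_existsb => i; rewrite negbK.
Qed.

(** * Search loop over the vertices *)

Section Loop.
Variables (d : nat) (p : prog).

(** Once the answer at address 0 is 1, the equality test is 0 and the upper bound of the counter
    drops to 0: the loop stops at the first witness. *)
Definition loop_test : expr :=
  Op Lt (Read (Const d.+1)) (Op Mul (Input (Const 0)) (Op Eq (Read (Const 0)) (Const 0))).

Definition loop_step : prog :=
  Write (Const d.+1) (Op Add (Read (Const d.+1)) (Const 1)).

Definition loop : prog :=
  Seq (Write (Const 0) (Const 0))
      (Seq (Write (Const d.+1) (Const 0)) (While loop_test (Seq p loop_step))).

Variables (c : nat) (G : sgraph) (m : memory) (T : nat) (B : pred nat).
Hypothesis lt_dc : d.+1 < c.
Hypothesis run_p : forall m1 j,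
    (forall i, i < d -> m1 i.+1 = m i.+1) -> m1 d.+1 = j -> j < #|G| ->
  exists t m', [/\ exec (word_size c #|G|) (encode G) p m1 t m', t <= T,
    m' 0 = B j & forall i, i < d.+1 -> m' i.+1 = m1 i.+1].

Notation w := (word_size c #|G|).
Notation inp := (encode G).

Let const_small a : a <= d.+1 -> to_word w a = a.
Proof. by move=> le_a; rewrite to_word_small // word_size_const //; lia. Qed.

Let card_small j : j <= #|G| -> to_word w j = j.
Proof.
move=> le_j; apply: to_word_small; apply: leq_ltn_trans (word_size_sqr _ _).
  by nia.
by lia.
Qed.

Lemma eval_loop_test (m1 : memory) (b : bool) :
  m1 0 = b -> eval w inp m1 loop_test = (m1 d.+1 < #|G|) && ~~ b.
Proof.
move=> m10; have : nth 0 inp 0 = #|G| by [].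
move: inp => ws ws0; rewrite /loop_test /eval.
rewrite (const_small (leqnn _)) !(const_small (leq0n _)) ws0 m10.
rewrite (card_small (leqnn _)) /eval_binop; case: b {m10} => /=.
  rewrite (const_small (leq0n _)) muln0 (const_small (leq0n _)) ltn0.
  by rewrite const_small ?andbF.
rewrite (const_small (ltn0Sn d)) muln1 (card_small (leqnn _)) andbT.
by rewrite const_small //; case: ltnP.
Qed.

(** Induction on the number [s] of vertices still to be tried, where [b] is the answer so far. The
    10 per round covers the 6 of [loop_step] and the unit cost of [While]. *)
Lemma run_while s (m1 : memory) (b : bool) :
    (forall i, i < d -> m1 i.+1 = m i.+1) -> m1 0 = b ->
    m1 d.+1 + s = #|G| ->
  exists t m', [/\ exec w inp (While loop_test (Seq p loop_step)) m1 t m',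
    t <= (T + cost loop_test + 10) * s + cost loop_test + 1,
    m' 0 = b || has B (iota (m1 d.+1) s) &
    forall i, i < d -> m' i.+1 = m i.+1].
Proof.
elim: s m1 b => [|s IHs] m1 b m1S m10 sumG.
  exists (cost loop_test).+1, m1; split=> //; last by rewrite orbF.
    by apply: ExecWhileFalse; rewrite (eval_loop_test m10) -sumG addn0 ltnn.
  by rewrite muln0 addn1.
case: b m10 => m10.
  exists (cost loop_test).+1, m1; split=> //; last by lia.
  by apply: ExecWhileFalse; rewrite (eval_loop_test m10) andbF.
have lt_j : m1 d.+1 < #|G| by lia.
have [t [m2 [ex_p le_t m20 m2S]]] := run_p m1S (erefl _) lt_j.
pose m3 := update m2 (eval w inp m2 (Const d.+1))
                  (eval w inp m2 (Op Add (Read (Const d.+1)) (Const 1))).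
have ex_step : exec w inp loop_step m2 6 m3 by apply: ExecWrite.
have m3d : m3 d.+1 = (m1 d.+1).+1.
  rewrite /m3 /update /eval (const_small (leqnn _)) eqxx.
  by rewrite (const_small (ltn0Sn d)) m2S // /eval_binop addn1 card_small.
have m3E a : a <= d -> m3 a = m2 a.
  move=> le_a; rewrite /m3 /update /eval (const_small (leqnn _)).
  by case: eqP => //; lia.
have [i lti|||t' [m4 [ex_w le_t' m40 m4S]]] := IHs m3 (B (m1 d.+1)).
- by rewrite m3E // m2S ?m1S // ltnS ltnW.
- by rewrite m3E.
- by rewrite m3d; lia.
exists (cost loop_test + (t + 6) + t').+1, m4; split=> //.
- apply: ExecWhileTrue ex_w; last exact: ExecSeq ex_p ex_step.
  by rewrite (eval_loop_test m10) lt_j.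
- by nia.
- by rewrite m40 m3d.
Qed.

Lemma run_loop : exists t m', [/\ exec w inp loop m t m',
  t <= (T + cost loop_test + 10) * #|G| + cost loop_test + 10,
  m' 0 = has B (iota 0 #|G|) & forall i, i < d -> m' i.+1 = m i.+1].
Proof.
pose m1 := update m 0 0; pose m2 := update m1 d.+1 0.
have ex1 : exec w inp (Write (Const 0) (Const 0)) m 3 m1.
  by have := ExecWrite w inp (Const 0) (Const 0) m; rewrite /= const_small.
have ex2 : exec w inp (Write (Const d.+1) (Const 0)) m1 3 m2.
  by have := ExecWrite w inp (Const d.+1) (Const 0) m1; rewrite /= !const_small.
have m2d : m2 d.+1 = 0 by rewrite /m2 /update eqxx.
have [i lti||| t [m3 [ex3 le_t m30 m3S]]] := @run_while #|G| m2 false.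
- by rewrite /m2 /m1 /update eqSS ltn_eqF.
- by rewrite /m2 /m1 /update.
- by rewrite m2d.
exists (3 + (3 + t)), m3; split=> //.
- by apply: ExecSeq ex1 _; apply: ExecSeq ex2 _.
- by lia.
- by rewrite m30 m2d.
Qed.

End Loop.

Definition set_var (G : sgraph) (rho : nat -> G) (d : nat) (x : G) : nat -> G :=
  fun i => if i == d then x else rho i.

(** One loop makes at most [#|G|] runs of the body; its overhead is absorbed because a valuation
    forces the graph to be nonempty. *)
Lemma checkable_ex d q P :
    checkable d.+1 q P ->
  checkable d q.+1 (fun G rho => [exists x, P G (set_var rho d x)]).
Proof.
case=> p [C [c0 runP]].
pose K := cost (loop_test d) + 10.
exists (loop d p), (C + K + K), (maxn c0 d.+2) => c G rho m.
rewrite geq_max => /andP[le_c0 le_c] rhom.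
pose x0 := rho 0; pose B j := P G (set_var rho d (nth x0 (enum G) j)).
have [m1 j m1S m1d ltj|t [m' [ex_l le_t m'0 m'S]]] :=
    @run_loop d p c G m (C * #|G| ^ q) B le_c.
  have [i|t [m' ?]] := runP c G (set_var rho d (nth x0 (enum G) j)) m1 le_c0.
    rewrite ltnS leq_eqVlt /set_var => /orP[/eqP->|lti].
      by rewrite eqxx m1d /code index_uniq ?enum_uniq // -cardE.
    by rewrite ltn_eqF // m1S // rhom.
  by exists t, m'.
exists t, m'; split=> //.
  apply: leq_trans le_t _; have n_gt0 := card_valuation_gt0 rho.
  have nq_gt0 : 0 < #|G| ^ q by rewrite expn_gt0 n_gt0.
  rewrite -!addnA -/K expnS; nia.
rewrite m'0; congr nat_of_bool; apply/hasP/existsP => [[j _ Pj]|[x Px]].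
  by exists (nth x0 (enum G) j).
exists (code x); first by rewrite mem_iota ltn_code.
by rewrite /B nth_index ?mem_enum.
Qed.

(** The [r] fresh variables are bound by nested loops, the induction peeling off the innermost.
    Values of [rho'] from [d + r] on are harmless by [checkable_local]. *)
Lemma checkable_ex_block d r q P Q :
    checkable (d + r) q P ->
    (forall G rho, reflect
       (exists2 rho', forall i, i < d -> rho' i = rho i & P G rho') (Q G rho)) ->
  checkable d (q + r) Q.
Proof.
elim: r q P => [|r IHr] q P chkP reflQ.
  move: chkP; rewrite !addn0 => chkP; apply: checkable_ext (chkP) => G rho.
  apply/idP/reflQ => [Prho|[rho' eq_rho Prho']]; first by exists rho.
  by rewrite (checkable_local chkP (rho' := rho')) // => i /eq_rho.
have chkP' : checkable (d + r).+1 q P by rewrite -addnS.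
rewrite -addSnnS; apply: IHr (checkable_ex chkP') _ => G rho.
apply: (iffP (reflQ G rho)) => [[rho' eq_rho Prho']|].
  exists rho' => //; apply/existsP; exists (rho' (d + r)).
  rewrite (checkable_local chkP (rho' := rho')) // => i _.
  by rewrite /set_var; case: eqP => // ->.
case=> rho' eq_rho /existsP[x Px]; exists (set_var rho' (d + r) x) => // i lti.
by rewrite /set_var ltn_eqF ?eq_rho // ltn_addr.
Qed.

Lemma checkable_decidable q (P : sgraph -> Prop) Q :
    checkable 0 q Q -> (forall G, P G <-> exists rho, Q G rho) ->
  decidable_in_time_O P (fun n => n ^ q).
Proof.
(* The test catches the null graph, where [P] fails for want of a valuation and the untouched memory
   already answers 0; this takes the 4 units added to the bound. *)
move=> [p [C [c0 runQ]]] PQ; exists c0.+2, (If (Input (Const 0)) p Skip).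
exists (fun n => C * n ^ q + 4); split.
  exists (C + 4), 1 => n n_gt0; have : 0 < n ^ q by rewrite expn_gt0 n_gt0.
  by move: (_ ^ _) => N; nia.
move=> G.
have size_input : eval (word_size c0.+2 #|G|) (encode G) empty_memory
                       (Input (Const 0)) = #|G|.
  rewrite /= [to_word _ 0]to_word_small ?expn_gt0 //= to_word_small //.
  by apply: leq_ltn_trans (word_size_sqr _ _) => //; nia.
case: (posnP #|G|) => [n0|/card_gt0P[x0 _]].
  exists 4, empty_memory; split=> //.
  - by apply: ExecIfFalse; [rewrite size_input | apply: ExecSkip].
  - by rewrite leq_addl.
  - by case/PQ=> rho; have := card_valuation_gt0 rho; rewrite n0.
pose rho0 (_ : nat) := x0.
have [||t [m' [ex_p le_t m'0 _]]] := runQ c0.+2 G rho0 empty_memory => //.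
  by rewrite ltnW.
exists (cost (Input (Const 0)) + t).+1, m'; split.
- by apply: ExecIfTrue ex_p; rewrite size_input -lt0n (card_valuation_gt0 rho0).
- by rewrite /=; move: (_ ^ _) le_t => N; lia.
- case/PQ=> rho Qrho; have chkQ : checkable 0 q Q by exists p, C, c0.
  have eqQ := @checkable_local 0 q Q G rho0 rho chkQ.
  by rewrite m'0 eqQ ?Qrho.
- move=> nP; rewrite m'0; case Qrho: (Q G rho0) => //.
  by case: nP; apply/PQ; exists rho0.
Qed.

(** * The certificates as first-order queries *)

Section Blocks.
Variable r : nat.

(** Repetitions are allowed, so tuples represent all nonempty sets of at most [r] vertices. *)
Definition tuple_set (G : sgraph) (rho : nat -> G) (a : 'I_r -> nat) : {set G} :=
  [set rho (a i) | i in 'I_r].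

Definition below (a : 'I_r -> nat) d := forall i, a i < d.

Definition segment d : 'I_r -> nat := fun i => d + i.

Lemma below_segment d e : d + r <= e -> below (segment d) e.
Proof. by move=> le_dr i; apply: leq_trans le_dr; rewrite ltn_add2l. Qed.

(** The clique refuting transversality is sought in the fresh variables [d], ..., [d + r - 1],
    whence the exponent [r]. *)
Lemma checkable_clique_transversal d q (a : 'I_r -> nat) :
    below a d -> r <= q ->
  checkable d q (fun G rho => clique_transversal (tuple_set rho a)).
Proof.
move=> lt_a le_rq; apply: checkable_leq le_rq _.
pose apart : query := fun G rho =>
  [forall i : 'I_r, ~~ (rho (d + i) == rho (a i)) && ~~ adj (rho (d + i)) (rho (a i))].
pose clq : query := fun G rho => [forall i : 'I_r, [forall j : 'I_r,
  (rho (d + i) == rho (d + j)) || adj (rho (d + i)) (rho (d + j))]].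
have ltd (i : 'I_r) : d + i < d + r by rewrite ltn_add2l.
have lta i : a i < d + r by rewrite ltn_addr.
have chk : checkable (d + r) 0 (fun G rho => apart G rho && clq G rho).
  apply: checkable_and; apply: checkable_forall => i; last first.
    apply: checkable_forall => j.
    by apply: checkable_or; [apply: checkable_eq | apply: checkable_adj].
  by apply: checkable_and; apply: checkable_neg;
    [apply: checkable_eq | apply: checkable_adj].
pose avoided : query := fun G rho => ~~ clique_transversal (tuple_set rho a).
have := checkable_ex_block (Q := avoided) chk; rewrite add0n => chkN.
apply: checkable_ext (checkable_neg (chkN _)) => G rho.
  exact: negbK.
apply: (iffP (not_clique_transversal_imsetP _)) => [[w [we clw]]|].
  (* Truncated subtraction gives 0 for [n < d], hence the additional test [d <= n]. *)
  pose rho' n := if insub (n - d) is Some i then if d <= n then w i else rho n else rho n.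
  have rho'w (i : 'I_r) : rho' (d + i) = w i by rewrite /rho' addKn valK leq_addr.
  have rho'a i : i < d -> rho' i = rho i.
    by move=> lti; rewrite /rho' [d <= i]leqNgt lti; case: insub.
  exists rho' => //; apply/andP; split; apply/forallP => i.
    by rewrite rho'w rho'a ?lt_a //; apply/andP; apply: we.
  by apply/forallP => j; rewrite !rho'w.
case=> rho' eq_rho /andP[/forallP we /forallP clw].
exists (fun i : 'I_r => rho' (d + i)); split=> [i|i j].
  by apply/andP; rewrite -(eq_rho (a i)).
by move/forallP: (clw i); apply.
Qed.

Lemma tuple_set_segment d (G : sgraph) (rho : nat -> G) (S : {set G}) :
    S != set0 -> #|S| <= r ->
  exists2 rho', forall i, i < d -> rho' i = rho i & tuple_set rho' (segment d) = S.
Proof.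
case/set0Pn=> x0 Sx0 leS; pose s := enum S.
exists (fun i => if i < d then rho i else nth x0 s (i - d)) => [i ->//|].
have sz : size s = #|S| by rewrite cardE.
apply/setP => x; apply/imsetP/idP => [[i _ ->]|Sx].
  rewrite /segment ltnNge leq_addr addKn /=.
  have [lti|gei] := ltnP i (size s); last by rewrite nth_default.
  by rewrite -mem_enum mem_nth.
have ltx : index x s < r by apply: leq_trans leS; rewrite -sz index_mem mem_enum.
exists (Ordinal ltx) => //.
by rewrite /segment ltnNge leq_addr addKn /= nth_index ?mem_enum.
Qed.

Lemma card_tuple_set (G : sgraph) (rho : nat -> G) a : #|tuple_set rho a| <= r.
Proof. by apply: leq_trans (leq_imset_card _ _) _; rewrite card_ord. Qed.

Lemma small_transversal_tuple_set (G : sgraph) (rho : nat -> G) a :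
  small_transversal r (tuple_set rho a) = clique_transversal (tuple_set rho a).
Proof. by rewrite /small_transversal card_tuple_set. Qed.

Lemma small_transversal_segment d (G : sgraph) (rho : nat -> G) (S : {set G}) :
    small_transversal r S ->
  exists2 rho', forall i, i < d -> rho' i = rho i & tuple_set rho' (segment d) = S.
Proof. by case/andP=> leS /clique_transversal_neq0/tuple_set_segment; apply. Qed.

Lemma eq_tuple_set d (G : sgraph) (rho rho' : nat -> G) a :
    below a d -> (forall i, i < d -> rho' i = rho i) ->
  tuple_set rho' a = tuple_set rho a.
Proof. by move=> lt_a eq_rho; apply: eq_imset => i; apply: eq_rho. Qed.

Lemma checkable_has_dominating_vertex : 0 < r ->
  checkable 0 (3 * r) (fun G _ => has_dominating_vertex G r).
Proof.
(* One loop for [z] (variable 0), [r] for the small transversal and [r] for the clique that would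
   refute it. *)
move=> r_gt0; apply: (@checkable_leq _ ((r + r) + 1)); first by lia.
pose undominated : query := fun G rho =>
  clique_transversal (tuple_set rho (segment 1)) &&
  [forall i : 'I_r, ~~ adj (rho 0) (rho (segment 1 i))].
have chk1 : checkable (1 + r) r undominated.
  apply: checkable_and.
    exact: checkable_clique_transversal (below_segment _) _.
  apply: checkable_leq (leq0n r) (checkable_forall _) => i.
  by apply: checkable_neg; apply: checkable_adj; rewrite // ltn_add2l.
pose dominating : query := fun G rho =>
  [forall S, small_transversal r S ==> [exists x in S, adj (rho 0) x]].
have chk2 : checkable 1 (r + r) (fun G rho => ~~ dominating G rho).
  apply: checkable_ex_block chk1 _ => G rho.
  apply: (iffP forallPn) => [[S]|[rho' eq_rho /andP[tS /forallP und]]].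
    rewrite negb_imply => /andP[smallS /exists_inPn und].
    have [rho' eq_rho eqS] := small_transversal_segment 1 rho smallS.
    exists rho' => //; rewrite /undominated eqS; have /andP[_ ->] := smallS.
    apply/forallP => i; rewrite eq_rho //; apply: und.
    by rewrite -eqS imset_f.
  exists (tuple_set rho' (segment 1)).
  rewrite negb_imply small_transversal_tuple_set tS /=.
  by apply/exists_inPn => _ /imsetP[i _ ->]; rewrite -eq_rho.
apply: (@checkable_ex_block 0 1 _ dominating) => [|G rho].
  by apply: checkable_ext (checkable_neg chk2) => G rho; rewrite negbK.
apply: (iffP existsP) => [[z domz]|[rho' _ dom]]; last by exists (rho' 0).
by exists (fun _ => z).
Qed.

Definition joint (x : 'I_r + 'I_r) : nat :=
  match x with inl i => segment 0 i | inr j => segment r j end.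

(** The excluded sets are indexed by maps [s] into the [2 * r] positions of the two tuples. There
    are [(2 * r) ^ r] of them whatever the graph, so no loop over vertices is spent on them. *)
Definition exchange_free_at (i j : 'I_r) : query := fun G rho =>
  let u := rho (segment 0 i) in let v := rho (segment r j) in
  [&& [forall l, ~~ (u == rho (segment r l))], [forall l, ~~ (v == rho (segment 0 l))],
      ~~ adj u v &
   [forall s : {ffun 'I_r -> 'I_r + 'I_r},
     [forall l, ~~ (rho (joint (s l)) == u) && ~~ (rho (joint (s l)) == v)] ==>
     ~~ clique_transversal (tuple_set rho (joint \o s))]].

Lemma exchange_free_atE i j G rho :
  @exchange_free_at i j G rho =
  exchange_free r (tuple_set rho (segment 0)) (tuple_set rho (segment r))
                (rho (segment 0 i)) (rho (segment r j)).
Proof.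
have notin x a : [forall l : 'I_r, ~~ (x == rho (a l))] = (x \notin tuple_set rho a).
  apply/forallP/idP => [nx|].
    by apply/imsetP => -[l _ ex]; case/negP: (nx l); rewrite ex.
  by move=> nx l; apply: contraNneq nx => ->; apply: imset_f.
rewrite /exchange_free_at /exchange_free !notin; do 3 congr (_ && _).
set u := rho _; set v := rho _; set S := tuple_set _ _; set T := tuple_set _ _.
have mem_joint x : x \in S :|: T -> exists y, rho (joint y) = x.
  by case/setUP=> /imsetP[l _ ->]; [exists (inl l) | exists (inr l)].
have joint_mem y : rho (joint y) \in S :|: T.
  by case: y => l; apply/setUP; [left | right]; apply: imset_f.
apply/forallP/forallP => [noW R|noW s]; apply/implyP; last first.
  move=> /forallP sW; rewrite -small_transversal_tuple_set.
  apply: (implyP (noW _)); apply/subsetP => _ /imsetP[l _ ->].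
  by rewrite in_setD joint_mem andbT !inE negb_or; apply: sW.
move=> subR; apply/negP => smallR.
(* [R] is listed as an [r]-tuple, and [s] picks for each entry a position where it occurs in the two
   given tuples. *)
have [rho' _ defR] := small_transversal_segment 0 rho smallR.
have Rl l : rho' (segment 0 l) \in R by rewrite -defR imset_f.
have ex_y l : exists y, rho (joint y) == rho' (segment 0 l).
  have [|y <-] := mem_joint (rho' (segment 0 l)); last by exists y.
  by have /setDP[] := subsetP subR _ (Rl l).
pose s := [ffun l => xchoose (ex_y l)].
have sE l : rho (joint (s l)) = rho' (segment 0 l).
  by rewrite ffunE; apply/eqP; apply: (xchooseP (ex_y l)).
have defR' : tuple_set rho (joint \o s) = R by rewrite -defR; apply: eq_imset.
have := noW s; rewrite defR'; have /andP[_ ->] := smallR; rewrite implybF.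
case/negP; apply/forallP => l; rewrite sE -negb_or.
by have := subsetP subR _ (Rl l); rewrite in_setD in_set2 => /andP[].
Qed.

Lemma checkable_exchange_free_at i j :
  checkable (r + r) r (exchange_free_at i j).
Proof.
have lt0 l : segment 0 l < r + r by apply: below_segment; rewrite leq_addl.
have ltr l : segment r l < r + r by apply: below_segment.
have ltj y : joint y < r + r by case: y => l; [apply: lt0 | apply: ltr].
have atom := checkable_leq (leq0n r).
do 3?[apply: checkable_and].
- by apply/atom/checkable_forall => l; apply/checkable_neg/checkable_eq.
- by apply/atom/checkable_forall => l; apply/checkable_neg/checkable_eq.
- by apply/atom/checkable_neg/checkable_adj.
apply: checkable_forall => s; apply: checkable_imply.
  by apply/atom/checkable_forall => l; apply: checkable_and;
    apply/checkable_neg/checkable_eq.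
by apply/checkable_neg/checkable_clique_transversal => // l; apply: ltj.
Qed.

Lemma checkable_has_exchange_free_pair :
  checkable 0 (3 * r) (fun G _ => has_exchange_free_pair G r).
Proof.
(* [r + r] loops choose the two transversals; [r] more serve every transversality test. The choice
   of [u] and [v] is a choice of positions, hence free. *)
have -> : 3 * r = r + (r + r) by lia.
pose pair_at : query := fun G rho =>
  [&& clique_transversal (tuple_set rho (segment 0)),
      clique_transversal (tuple_set rho (segment r)) &
      [exists i, exists j, exchange_free_at i j rho]].
have chk : checkable (0 + (r + r)) r pair_at.
  apply: checkable_and; last apply: checkable_and.
  - by apply: checkable_clique_transversal => //; apply: below_segment; rewrite leq_addl.
  - by apply: checkable_clique_transversal => //; apply: below_segment.
  apply: checkable_exists => i; apply: checkable_exists => j.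
  exact: checkable_exchange_free_at.
apply: checkable_ex_block chk _ => G rho.
apply: (iffP existsP) => [[S /existsP[T /and3P[smallS smallT]]]|].
  case/exists_inP=> u Su /exists_inP[v Tv free].
  have [rho1 _ defS] := small_transversal_segment 0 rho smallS.
  have [rho2 eq_rho defT] := small_transversal_segment r rho1 smallT.
  have defS2 : tuple_set rho2 (segment 0) = S.
    by rewrite -defS; apply: eq_tuple_set eq_rho; apply: below_segment.
  exists rho2 => //; rewrite /pair_at defS2 defT.
  have /andP[_ ->] := smallS; have /andP[_ ->] := smallT.
  move: Su Tv free; rewrite -defS2 -defT => /imsetP[i _ ->] /imsetP[j _ ->] free.
  by apply/existsP; exists i; apply/existsP; exists j; rewrite exchange_free_atE.
case=> rho' _ /and3P[tS tT /existsP[i /existsP[j]]]; rewrite exchange_free_atE => free.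
exists (tuple_set rho' (segment 0)); apply/existsP; exists (tuple_set rho' (segment r)).
rewrite !small_transversal_tuple_set tS tT; apply/exists_inP.
exists (rho' (segment 0 i)); first exact: imset_f.
by apply/exists_inP; exists (rho' (segment r j)) => //; apply: imset_f.
Qed.

End Blocks.

Theorem theorem4p1 (k : nat) (hk : 2 <= k) :
  decidable_in_time_O (has_large_minimal_clique_transversal k)
    (fun n => n ^ (3 * k - 3)).
Proof.
case: k hk => // r r_gt0; rewrite ltnS in r_gt0.
have -> : 3 * r.+1 - 3 = 3 * r by lia.
apply: checkable_decidable (checkable_or (checkable_has_dominating_vertex r_gt0)
  (checkable_has_exchange_free_pair r)) _ => G.
split=> [/has_large_minimal_clique_transversalS yes|[_ yes]]; last first.
  exact/has_large_minimal_clique_transversalS.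
(* Either certificate contains a vertex, so a valuation exists. *)
suff [x] : inhabited G by exists (fun _ => x).
by case/orP: yes => [/existsP[z]|/existsP[S /existsP[T /and3P[_ _ /exists_inP[u]]]]];
  constructor.
Qed.
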